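(* The aggregation methods MT and MTC satisfy Strong Proportional Representation (Strong-PR), while the aggregation methods EwT and EwTC fail Strong-PR. Here an aggregation method $\mathcal{R}$ satisfies Strong-PR if for each budgeting scenario $E=(P,V,c,L)$ with $n=|V|$, each $\ell\in\{1,\dots,L\}$, each $V'\subseteq V$ with $|V'|\ge \ell n/L$, and each $P'\subseteq P$, the following holds: if all voters in $V'$ support all projects in $P'$ and do not support any other project, then either $P'\subseteq\mathcal{R}(E)$, or for each $p\in P'\setminus\mathcal{R}(E)$ we have $c(p)+c(P'\cap\mathcal{R}(E))>\ell$.
   Context: Setting. A budgeting scenario is a tuple $E=(P,V,c,L)$: a finite set of projects $P=\{p_1,\dots,p_m\}$; each project $p$ has a cost $c(p)\in\{1,2,\dots\}$; a finite nonempty set of voters $V=\{v_1,\dots,v_n\}$, where voter $v_j$ casts a cumulative ballot, i.e. values $v_j(p)\ge 0$ with $\sum_{p\in P}v_j(p)=1$; and a budget limit $L\in\{1,2,\dots\}$. Voter $v_j$ supports $p$ if $v_j(p)>0$ (in the given ballot). For $B\subseteq P$: $c(B)=\sum_{p\in B}c(p)$, $v_j(B)=\sum_{p\in B}v_j(p)$. An aggregation method $\mathcal{R}$ maps each scenario $E$ to a bundle $\mathcal{R}(E)\subseteq P$ with $c(\mathcal{R}(E))\le L$. Ties are resolved by an arbitrary fixed tie-breaking rule. Rules EwT, EwTC, MT, MTC. Each rule keeps a current version of the values $v_j(p)$ (starting from the given ballots, called the initial supports), a set $S$ of selected projects (initially $\emptyset$), and the remaining budget $L-c(S)$. At any time,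 with the current values and the original $L$, $\mathrm{support}(p)=\frac{L}{n}\sum_{j}v_j(p)$ and $\mathrm{excess}(p)=\mathrm{support}(p)-c(p)$. A not-yet-selected (and not eliminated) project $p$ is eligible for funding if $\mathrm{support}(p)\ge c(p)$. The rule loops as follows. (A) If some project is eligible for funding, choose the eligible project $p$ with the highest $\mathrm{excess}(p)$ (in EwT and MT) or the highest $\mathrm{support}(p)/c(p)$ (in EwTC and MTC). If $\mathrm{support}(p)>c(p)$, redistribute the excess: let $\mathrm{tran}(p)$ be the set of voters with $v_j(p)>0$ who also have positive current value on some other project that is not yet selected (nor eliminated); find $\gamma\in[0,1)$ with $\frac{\gamma L}{n}\sum_{v_j\in \mathrm{tran}(p)}v_j(p)+\frac{L}{n}\sum_{v_j\notin \mathrm{tran}(p)}v_j(p)=c(p)$ (if there is no such $\gamma$, bring the support as close to $c(p)$ as possible: use $\gamma=0$; if $\mathrm{tran}(p)=\emptyset$, nothing is transferred). Each $v_j\in\mathrm{tran}(p)$ moves the amount $(1-\gamma)v_j(p)$ from $p$ to the other not-yet-selected (and not eliminated) projects, proportionally to her initial supports for them. Then add $p$ to $S$ and set $v_j(p)=0$ for all $j$ (the voters pay for $p$). (B) If no project is eligible for funding: - In EwT and EwTC: eliminate the remaining project $p$ with minimal $\mathrm{excess}(p)$ (EwT) or minimal $\mathrm{excess}(p)/c(p)$ (EwTC). Each voter with $v_j(p)>0$ transfers that value to the other remaining (not selected, not eliminated) projects, proportionally to her initial supports for them; if she has support on none of them, no transfer is made. The loop ends when every project is selected or eliminated. Then (reverse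 eliminations): go through the eliminated projects in the order reverse to that of their elimination, and add each to the bundle if its cost does not exceed the remaining budget. - In MT and MTC: a not-yet-selected project $p$ is eligible for funding by transfers if $\frac{L}{n}\sum_{j:\,v_j(p)>0}\sum_{\ell=1}^m v_j(p_\ell)\ge c(p)$ (current values). Among these, choose the $p$ with maximal $\mathrm{excess}(p)$ (MT) or maximal $\mathrm{support}(p)/c(p)$ (MTC). Transfer support to $p$ by repeating (in the limit if necessary) until $r=1$: compute $r=\mathrm{support}(p)/c(p)$; if $r<1$, each $v_j$ with $v_j(p)>0$ changes $v_j(p)$ to $\min\big(\sum_{\ell=1}^m v_j(p_\ell),\,v_j(p)/r\big)$, taking the needed amount proportionally from her current values on other projects. Then $p$ is eligible and is selected as in (A). The loop ends when no unselected project is eligible for funding or eligible by transfers. Then (acceptance of undersupported projects): while some unselected project has cost at most the remaining budget, pick among such projects the $p$ maximizing $\frac{L}{n}\sum_{j:\,v_j(p)>0}\sum_{\ell=1}^m v_j(p_\ell)-c(p)$ (MT) or $\frac{1}{c(p)}\cdot\frac{L}{n}\sum_{j:\,v_j(p)>0}\sum_{\ell=1}^m v_j(p_\ell)$ (MTC); each voter with $v_j(p)>0$ transfers all her support from other projects to $p$; add $p$ to $S$ and set $v_j(p)=0$ for all $j$. The output is the set of all selected projects. *)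

(* Defs.v *)
From HB Require Import structures.
From mathcomp Require Import all_boot all_order all_algebra.
From mathcomp Require Import classical_sets boolp reals topology normedtype
  sequences.
(* [finset] is imported last so that [set0], [setT], ... are those of [{set T}],
   not of [classical_sets]. *)
From mathcomp Require Import finset.

Set Implicit Arguments.
Unset Strict Implicit.
Unset Printing Implicit Defensive.

Import Order.TTheory GRing.Theory Num.Theory.
Import numFieldNormedType.Exports.
Local Open Scope ring_scope.

Record scenario (R : realType) := Scenario {
  project : finType;
  voter : finType;
  cost : project -> nat;
  ballot : voter -> project -> R;
  limit : nat;
  cost_gt0 : forall p, (0 < cost p)%N;
  voter_gt0 : (0 < #|voter|)%N;
  ballot_ge0 : forall j p, 0 <= ballot j p;
  ballot_sum1 : forall j, \sum_p ballot j p = 1;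
  limit_gt0 : (0 < limit)%N }.

Arguments cost {R E} p : rename.
Arguments ballot {R E} j p : rename.

Definition bundle_cost (R : realType) (E : scenario R)
  (B : {set project E}) : nat := \sum_(p in B) cost p.

Record aggregation_method (R : realType) := AggregationMethod {
  outcome :> forall E : scenario R, {set project E};
  outcome_feasible : forall E, (bundle_cost (outcome E) <= limit E)%N }.

Definition strong_PR (R : realType) (M : aggregation_method R) : Prop :=
  forall (E : scenario R) (l : nat) (V' : {set voter E}) (P' : {set project E}),
    (1 <= l <= limit E)%N ->
    l%:R * #|voter E|%:R / (limit E)%:R <= #|V'|%:R :> R ->
    (forall j, j \in V' -> forall p, (0 < ballot j p) = (p \in P')) ->
    P' \subset M E \/
    forall p, p \in P' :\: M E -> (l < cost p + bundle_cost (P' :&: M E))%N.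

(* Every step of the rules takes its project out of further consideration, so
   the same set of tied projects never occurs twice in a run: choosing as a
   function of the tied set covers every way of resolving the ties of a run. *)
Record tie_breaking (R : realType) := TieBreaking {
  tie_choice :> forall E : scenario R, {set project E} -> project E;
  tie_choice_in : forall (E : scenario R) (A : {set project E}),
    A != set0 -> tie_choice A \in A }.

Section Values.
Variables (R : realType) (E : scenario R).

Definition values := voter E -> project E -> R.
Implicit Types (v : values) (p q : project E) (j : voter E).

Definition unit_value : R := (limit E)%:R / #|voter E|%:R.

Definition support v p : R := unit_value * \sum_j v j p.

Definition excess v p : R := support v p - (cost p)%:R.

Definition holdings v j : R := \sum_q v j q.

Definition potential v p : R := unit_value * \sum_(j | 0 < v j p) holdings v j.

(* [rest] is the set of projects that are neither selected nor eliminated;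
   voter [j] in [A] moves the amount [a j] from [p] to [rest :\ p]. *)
Definition transfer (rest : {set project E}) p (A : {set voter E})
    (a : voter E -> R) v : values :=
  fun j q =>
    if j \in A then
      if q == p then v j p - a j
      else if q \in rest then
        v j q + a j * (ballot j q / \sum_(q' in rest :\ p) ballot j q')
      else v j q
    else v j q.

Definition tran (rest : {set project E}) p v : {set voter E} :=
  [set j | (0 < v j p) && [exists q in rest :\ p, 0 < v j q]].

(* The default 0 of [xget] is the case where no such number exists. *)
Definition gamma (rest : {set project E}) p v : R :=
  xget 0 (fun g : R => (0 <= g < 1) /\
    g * unit_value * \sum_(j in tran rest p v) v j p
      + unit_value * \sum_(j | j \notin tran rest p v) v j p = (cost p)%:R).

Definition redistribute (rest : {set project E}) p v : values :=
  if (cost p)%:R < support v p then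
    transfer rest p (tran rest p v) (fun j => (1 - gamma rest p v) * v j p) v
  else v.

Definition pay p v : values := fun j q => if q == p then 0 else v j q.

Definition transfer_eliminated (rest : {set project E}) p v : values :=
  transfer rest p
    [set j | (0 < v j p) && [exists q in rest :\ p, 0 < ballot j q]]
    (fun j => v j p) v.

Definition raise p v : values :=
  let r := support v p / (cost p)%:R in
  if r < 1 then
    fun j q =>
      if 0 < v j p then
        let x := Num.min (holdings v j) (v j p / r) in
        if q == p then x
        else v j q - (x - v j p) * (v j q / \sum_(q' | q' != p) v j q')
      else v j q
  else v.

(* [raise p] is the identity as soon as the support of [p] reaches its cost, so
   the limit also accounts for the runs that stop after finitely many rounds. *)
Definition transfer_support p v : values :=
  fun j q => limn (fun k => iter k (raise p) v j q).

Definition concentrate p v : values :=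
  fun j q =>
    if 0 < v j p then (if q == p then holdings v j else 0) else v j q.

(* [eliminated] lists the eliminated projects, the latest one first. *)
Record state := State {
  value : values;
  selected : {set project E};
  eliminated : seq (project E) }.

Definition initial : state := State (@ballot R E) set0 [::].

Definition remaining (s : state) : {set project E} :=
  [set p | (p \notin selected s) && (p \notin eliminated s)].

Definition eligible (s : state) : {set project E} :=
  [set p in remaining s | (cost p)%:R <= support (value s) p].

Definition fund p (s : state) : state :=
  State (pay p (redistribute (remaining s) p (value s)))
        (p |: selected s) (eliminated s).

Definition eliminate p (s : state) : state :=
  State (transfer_eliminated (remaining s) p (value s)) (selected s) (p :: eliminated s).

Definition affordable (S : {set project E}) p : bool :=
  (bundle_cost S + cost p <= limit E)%N.

Variable tie : tie_breaking R.

Definition best (A : {set project E}) (score : project E -> R) : project E :=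
  tie E [set p in A | [forall q in A, score q <= score p]].

Section Elimination.
Variables fund_score elim_score : values -> project E -> R.

Definition ew_step (s : state) : state :=
  if eligible s != set0 then
    fund (best (eligible s) (fund_score (value s))) s
  else if remaining s != set0 then
    eliminate (best (remaining s) (fun p => - elim_score (value s) p)) s
  else s.

Definition reverse_eliminations (s : state) : {set project E} :=
  foldl (fun S p => if affordable S p then p |: S else S)
        (selected s) (eliminated s).

(* Each effective step selects or eliminates a project, so the loop is over
   after as many steps as there are projects. *)
Definition ew_rule : {set project E} :=
  reverse_eliminations (iter #|project E| ew_step initial).

End Elimination.

(* No project is ever eliminated here: [eliminated] stays empty. *)
Section Transfers.
Variables fund_score accept_score : values -> project E -> R.

Definition transfer_eligible (s : state) : {set project E} :=
  [set p in remaining s | (cost p)%:R <= potential (value s) p].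

Definition mt_step (s : state) : state :=
  if eligible s != set0 then
    fund (best (eligible s) (fund_score (value s))) s
  else if transfer_eligible s != set0 then
    let p := best (transfer_eligible s) (fund_score (value s)) in
    fund p (State (transfer_support p (value s)) (selected s) (eliminated s))
  else s.

Definition acceptable (s : state) : {set project E} :=
  [set p in remaining s | affordable (selected s) p].

Definition accept_step (s : state) : state :=
  if acceptable s != set0 then
    let p := best (acceptable s) (accept_score (value s)) in
    State (pay p (concentrate p (value s))) (p |: selected s) (eliminated s)
  else s.

Definition mt_rule : {set project E} :=
  selected (iter #|project E| accept_step
    (iter #|project E| mt_step initial)).

End Transfers.

Definition support_per_cost v p : R := support v p / (cost p)%:R.

End Values.

Section Feasibility.
Variables (R : realType) (E : scenario R).
Implicit Types (v w : values E) (p q : project E) (j : voter E).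
Implicit Types (A : {set voter E}) (a : voter E -> R).
Implicit Types (S rest : {set project E}) (s : state E).

Let nonneg v := forall j q, 0 <= v j q.

Let unit_gt0 : 0 < unit_value E.
Proof. by rewrite divr_gt0 ?ltr0n ?limit_gt0 ?voter_gt0. Qed.

Let cost_pos p : 0 < (cost p)%:R :> R.
Proof. by rewrite ltr0n cost_gt0. Qed.

Let holdingsD1 v p j : holdings v j = v j p + \sum_(q | q != p) v j q.
Proof. by rewrite /holdings (bigD1 p). Qed.

Let others_ge0 v p j : nonneg v -> 0 <= \sum_(q | q != p) v j q.
Proof. by move=> v0; apply: sumr_ge0. Qed.

Let transfer_ge0 rest p A a v : nonneg v ->
  (forall j, j \in A -> 0 <= a j <= v j p) -> nonneg (transfer rest p A a v).
Proof.
move=> v0 ha j q; rewrite /transfer; case: ifP => // /ha /andP[a0 av].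
have [_|_] := eqVneq q p; first by rewrite subr_ge0.
case: ifP => // _; rewrite addr_ge0 // mulr_ge0 // divr_ge0 ?ballot_ge0 //.
by apply: sumr_ge0 => *; apply: ballot_ge0.
Qed.

Let transfer_holdings rest p A a v j : nonneg v ->
  (forall j, j \in A -> 0 <= a j <= v j p) ->
  holdings (transfer rest p A a v) j <= holdings v j.
Proof.
move=> v0 ha; rewrite !(holdingsD1 _ p) /transfer eqxx.
case: ifP => [/ha /andP[a0 av]|_]; last by [].
set D := \sum_(q' in rest :\ p) ballot j q'.
suff H : \sum_(q | q != p) (if q == p then v j p - a j else if q \in rest then
    v j q + a j * (ballot j q / D) else v j q)
   <= \sum_(q | q != p) v j q + a j.
  by apply: le_trans (lerD (lexx _) H) _; rewrite [X in _ + X]addrC addrA subrK.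
have -> : \sum_(q | q != p) (if q == p then v j p - a j else if q \in rest then
    v j q + a j * (ballot j q / D) else v j q)
  = \sum_(q | q != p) v j q + a j * (D / D).
  rewrite (eq_bigr (fun q => v j q
      + (if q \in rest then a j * (ballot j q / D) else 0))); last first.
    by move=> q /negbTE ->; case: ifP => _ //; rewrite addr0.
  rewrite big_split /= -big_mkcondr /=; congr (_ + _).
  rewrite -mulr_sumr -mulr_suml; congr (_ * (_ / _)).
  by apply: eq_bigl => q; rewrite !inE.
rewrite lerD2l ler_piMr //; have [->|D0] := eqVneq D 0.
  by rewrite mul0r ler01.
by rewrite divff.
Qed.

Let gammaP rest p v : nonneg v -> (cost p)%:R < support v p ->
  0 <= gamma rest p v < 1 /\
  (cost p)%:R <= gamma rest p v * unit_value E * \sum_(j in tran rest p v) v j p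
      + unit_value E * \sum_(j | j \notin tran rest p v) v j p.
Proof.
move=> v0 cs; rewrite /gamma; case: xgetP => [g _ [g01 ->]|nog].
  by split.
rewrite lexx ltr01 !mul0r add0r; split => //.
rewrite leNgt; apply/negP => Nc.
move: cs; rewrite /support (bigID (mem (tran rest p v))) /= mulrDr.
set T := unit_value E * _ => cs.
have T0 : 0 < T.
  by rewrite -(ltrD2r (unit_value E * \sum_(j | j \notin tran rest p v) v j p))
       add0r (lt_trans Nc).
apply: (nog (((cost p)%:R
   - unit_value E * \sum_(j | j \notin tran rest p v) v j p) / T)).
split.
  by rewrite divr_ge0 ?subr_ge0 ?(ltW Nc) ?(ltW T0) //= ltr_pdivrMr // mul1r
    ltrBlDr.
by rewrite -[_ * unit_value E * _]mulrA -/T divfK ?subrK // gt_eqF.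
Qed.

Let redistributeP rest p v : nonneg v -> (cost p)%:R <= support v p ->
  [/\ nonneg (redistribute rest p v),
      forall j, holdings (redistribute rest p v) j <= holdings v j &
      (cost p)%:R <= support (redistribute rest p v) p].
Proof.
move=> v0 cs; rewrite /redistribute; case: ifP => [{}cs|_]; last by split.
have [/andP[g0 g1] gc] := gammaP rest v0 cs.
have ha j : j \in tran rest p v ->
    0 <= (1 - gamma rest p v) * v j p <= v j p.
  move=> _; rewrite mulr_ge0 ?subr_ge0 ?(ltW g1) //=.
  by rewrite ler_piMl // gerBl.
split; first exact: transfer_ge0.
  by move=> j; apply: transfer_holdings.
apply: le_trans gc _; rewrite /support [X in _ <= _ * X](bigID (mem (tran rest p v))) /=.
rewrite mulrDr -mulrA [gamma _ _ _ * _]mulrCA mulr_sumr lerD // ler_pM2l //.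
  by apply: ler_sum => j jt; rewrite /transfer jt eqxx mulrBl mul1r opprB addrC subrK.
by apply: ler_sum => j /negbTE jt; rewrite /transfer jt.
Qed.

Let feasible v S := nonneg v /\
  unit_value E * (\sum_j holdings v j) + (bundle_cost S)%:R <= (limit E)%:R.

Let feasible_le v w S : feasible v S -> nonneg w ->
  (forall j, holdings w j <= holdings v j) -> feasible w S.
Proof.
move=> [v0 vS] w0 wv; split => //; apply: le_trans vS.
by rewrite lerD2r ler_pM2l // ler_sum.
Qed.

Let bundle_costU1 p S : (bundle_cost (p |: S) <= bundle_cost S + cost p)%N.
Proof.
rewrite /bundle_cost; have [pS|pS] := boolP (p \in S).
  by rewrite (setUidPr _) ?sub1set // leq_addr.
by rewrite big_setU1 //= addnC.
Qed.

Let pay_ge0 v p : nonneg v -> nonneg (pay p v).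
Proof. by move=> v0 j q; rewrite /pay; case: ifP. Qed.

Let pay_holdings v p j : holdings (pay p v) j = holdings v j - v j p.
Proof.
rewrite !(holdingsD1 _ p) /pay eqxx add0r [v j p + _]addrC addrK.
by apply: eq_bigr => q /negbTE ->.
Qed.

Let feasible_pay v p S : feasible v S -> (cost p)%:R <= support v p ->
  feasible (pay p v) (p |: S).
Proof.
move=> [v0 vS] cs; split; first exact: pay_ge0.
under eq_bigr do rewrite pay_holdings.
rewrite sumrB mulrBr -/(support v p); apply: le_trans vS.
rewrite -addrA lerD2l addrC lerBlDr.
apply: (@le_trans _ _ ((bundle_cost S)%:R + (cost p)%:R)).
  by rewrite -natrD ler_nat.
by rewrite lerD2l.
Qed.

Let feasible_fund s p : feasible (value s) (selected s) ->
  (cost p)%:R <= support (value s) p ->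
  feasible (value (fund p s)) (selected (fund p s)).
Proof.
move=> fs cs; have [r0 rh rc] := redistributeP (remaining s) fs.1 cs.
exact: feasible_pay (feasible_le fs r0 rh) rc.
Qed.

Let feasible_eliminate s p : feasible (value s) (selected s) ->
  feasible (value (eliminate p s)) (selected s).
Proof.
move=> fs; have ha j : j \in [set j | (0 < value s j p)
    && [exists q in remaining s :\ p, 0 < ballot j q]] ->
    0 <= value s j p <= value s j p by move=> _; rewrite fs.1 lexx.
have v0 := fs.1; apply: (feasible_le fs); first exact: transfer_ge0.
by move=> j; apply: transfer_holdings.
Qed.

Let feasible_initial : feasible (value (initial E)) (selected (initial E)).
Proof.
split=> [j q|] /=; first exact: ballot_ge0.
rewrite /bundle_cost big_set0 addr0 /holdings.
under eq_bigr do rewrite ballot_sum1.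
rewrite sumr_const divfK //.
by rewrite pnatr_eq0 -lt0n voter_gt0.
Qed.

Let feasible_cost v S : feasible v S -> (bundle_cost S <= limit E)%N.
Proof.
move=> [v0 vS]; rewrite -(ler_nat R); apply: le_trans vS.
by rewrite lerDr mulr_ge0 ?(ltW unit_gt0) // sumr_ge0 // => j _; apply: sumr_ge0.
Qed.

Let best_in (tie : tie_breaking R) (A : {set project E}) score :
  A != set0 -> best tie A score \in A.
Proof.
case/set0Pn => p0 p0A.
have [|+ _] := setIdP (tie_choice_in tie (A := [set p in A |
    [forall q in A, score q <= score p]]) _); last by [].
apply/set0Pn; have [p pA pmax] := arg_maxP score p0A.
by exists p; rewrite inE; apply/andP; split => //; apply/forall_inP.
Qed.

Lemma ew_rule_feasible (tie : tie_breaking R) fund_score elim_score :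
  (bundle_cost (ew_rule (E := E) tie fund_score elim_score) <= limit E)%N.
Proof.
rewrite /ew_rule /reverse_eliminations; set s := iter _ _ _.
have /feasible_cost: feasible (value s) (selected s).
  rewrite {}/s; elim: #|project E| => [|k IH] //=.
  set s := iter k _ _ in IH *; rewrite /ew_step; case: ifP => [e0|_].
    apply: feasible_fund => //.
    by have := best_in tie (fund_score (value s)) e0; rewrite inE => /andP[].
  by case: ifP => // _; apply: feasible_eliminate.
elim: (eliminated s) (selected s) => //= p ps IH S Sf; apply: IH.
by case: ifP => // /(leq_trans (bundle_costU1 _ _)).
Qed.

Section RaiseStep.
Variables (p : project E) (w : values E).
Hypotheses (w0 : nonneg w) (s0 : 0 < support w p)
  (sc : support w p <= (cost p)%:R).

Let r := support w p / (cost p)%:R.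
Let r_gt0 : 0 < r. Proof. by rewrite divr_gt0. Qed.
Let r_le1 : r <= 1. Proof. by rewrite ler_pdivrMr ?mul1r. Qed.
Let x j := Num.min (holdings w j) (w j p / r).

Let x_ge j : w j p <= x j.
Proof.
rewrite le_min (holdingsD1 w p) lerDl others_ge0 //=.
by rewrite ler_pdivlMr // ler_piMr.
Qed.

Let x_le j : x j <= holdings w j. Proof. by rewrite ge_min lexx. Qed.

Let cut_ge0 j q : 0 <= (x j - w j p) * (w j q / \sum_(q' | q' != p) w j q').
Proof. by rewrite mulr_ge0 ?subr_ge0 ?x_ge // divr_ge0 ?others_ge0. Qed.

Let cut_le j q : q != p ->
  (x j - w j p) * (w j q / \sum_(q' | q' != p) w j q') <= w j q.
Proof.
move=> qp; set D := \sum_(q' | _) _.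
have [D0|D0] := eqVneq D 0; first by rewrite D0 invr0 !mulr0.
apply: (@le_trans _ _ (D * (w j q / D))); last by rewrite mulrCA divff ?mulr1.
rewrite ler_wpM2r ?divr_ge0 ?others_ge0 // lerBlDl.
by rewrite -(holdingsD1 w p).
Qed.

Let raise_cases : raise p w = w \/
  raise p w = (fun j q => if 0 < w j p then
        if q == p then x j
        else w j q - (x j - w j p) * (w j q / \sum_(q' | q' != p) w j q')
      else w j q).
Proof. by rewrite /raise -/r; case: ifP => _; [right|left]. Qed.

Let raise_ge0 : nonneg (raise p w).
Proof.
have [->|->] := raise_cases => // j q; case: ifP => // wp; have [_|qp] := eqVneq q p.
  exact: le_trans (w0 j p) (x_ge j).
by rewrite subr_ge0 cut_le.
Qed.

Let raise_holdings j : holdings (raise p w) j = holdings w j.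
Proof.
have [->|->] := raise_cases => //; rewrite !(holdingsD1 _ p) eqxx; case: ifP => // wp.
rewrite (eq_bigr (fun q => w j q
    - (x j - w j p) * (w j q / \sum_(q' | q' != p) w j q'))); last first.
  by move=> q /negbTE ->.
rewrite sumrB -mulr_sumr -mulr_suml; set D := \sum_(q | _) _.
have [D0|D0] := eqVneq D 0.
  rewrite D0 mul0r mulr0 subr0; congr (_ + _); apply/le_anti.
  by rewrite x_ge (le_trans (x_le j)) // (holdingsD1 w p) -/D D0 addr0.
by rewrite divff // mulr1 opprB addrC -addrA subrK addrC.
Qed.

Let raise_up j : w j p <= raise p w j p.
Proof. by have [->|->] := raise_cases => //; rewrite eqxx; case: ifP. Qed.

Let raise_down j q : q != p -> raise p w j q <= w j q.
Proof.
move=> qp; have [->|->] := raise_cases => //; rewrite (negbTE qp); case: ifP => // _.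
by rewrite gerBl cut_ge0.
Qed.

Let raise_support : support (raise p w) p <= (cost p)%:R.
Proof.
have [->|->] := raise_cases => //; rewrite /support.
apply: (@le_trans _ _ (unit_value E * ((\sum_j w j p) / r))).
  rewrite ler_pM2l // mulr_suml ler_sum // => j _.
  rewrite eqxx; case: ifP => [_|]; first by rewrite ge_min lexx orbT.
  by move=> _; rewrite ler_pdivlMr // ler_piMr.
by rewrite mulrA -/(support w p) invf_div mulrCA divff ?mulr1 // gt_eqF.
Qed.

Let raise_support_up : support w p <= support (raise p w) p.
Proof. by rewrite ler_pM2l // ler_sum. Qed.

Let raise_uncapped j : 0 < w j p -> raise p w j p < holdings w j ->
  raise p w j p * r = w j p.
Proof.
rewrite /raise -/r => wp; have [r1|r1] := ltP r 1.
  rewrite wp eqxx minEle -/(holdings w j); case: ifP; first by rewrite ltxx.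
  by rewrite divfK // gt_eqF.
by have /le_anti -> : r <= 1 <= r; rewrite ?r_le1 // mulr1.
Qed.

Lemma raiseP :
  [/\ nonneg (raise p w), 0 < support (raise p w) p <= (cost p)%:R,
      forall j, holdings (raise p w) j = holdings w j &
      (forall j, w j p <= raise p w j p) /\
      (forall j q, q != p -> raise p w j q <= w j q) /\
      (forall j, 0 < w j p -> raise p w j p < holdings w j ->
         raise p w j p * (support w p / (cost p)%:R) = w j p)].
Proof.
by split=> //; rewrite raise_support (lt_le_trans s0 raise_support_up).
Qed.

End RaiseStep.

Section RaiseLimit.
Local Open Scope classical_set_scope.
Local Open Scope ring_scope.
Variables (p : project E) (v : values E).
Hypotheses (v0 : nonneg v) (s0 : 0 < support v p)
  (sc : support v p <= (cost p)%:R) (pot : (cost p)%:R <= potential v p).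

Let w k := iter k (raise p) v.

Let wP k : [/\ nonneg (w k), 0 < support (w k) p <= (cost p)%:R &
  forall j, holdings (w k) j = holdings v j].
Proof.
elim: k => [|k [a0 /andP[b c] d]]; first by split => //=; rewrite s0.
have [a1 b1 d1 _] := raiseP a0 b c.
by split => //= j; rewrite d1 d.
Qed.

Let w_step k : (forall j, w k j p <= w k.+1 j p) /\
      (forall j q, q != p -> w k.+1 j q <= w k j q) /\
      (forall j, 0 < w k j p -> w k.+1 j p < holdings v j ->
         w k.+1 j p * (support (w k) p / (cost p)%:R) = w k j p).
Proof.
have [a0 /andP[b c] d] := wP k; have [_ _ _ [h1 [h2 h3]]] := raiseP a0 b c.
by split => //; split => // j wp; rewrite -d; apply: h3.
Qed.

Let w_cvg j q : cvgn (fun k => w k j q).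
Proof.
have [->|qp] := eqVneq q p.
  apply: nondecreasing_is_cvgn.
    by apply/nondecreasing_seqP => k; apply: (w_step k).1.
  exists (holdings v j) => _ [k _ <-]; have [h _ <-] := wP k.
  by rewrite (holdingsD1 _ p) lerDl others_ge0.
apply: nonincreasing_is_cvgn.
  by apply/nonincreasing_seqP => k; apply: (w_step k).2.1.
by exists 0 => _ [k _ <-]; have [h _ _] := wP k; apply: h.
Qed.

Let z := transfer_support p v.

Let w_to j q : (fun k => w k j q) @ \oo --> z j q.
Proof. exact: w_cvg. Qed.

Let z_ge0 : nonneg z.
Proof.
move=> j q; apply: limr_ge; first exact: w_cvg.
by apply: nearW => k; have [h _ _] := wP k; apply: h.
Qed.

Let sum_to (I : finType) (f : nat -> I -> R) (l : I -> R) :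
  (forall i, (fun k => f k i) @ \oo --> l i) ->
  (fun k => \sum_i f k i) @ \oo --> \sum_i l i.
Proof.
move=> fl; apply: (@cvg_big R I +%R 0 xpredT _ nat _ _ (fun i k => f k i)) => //.
exact: add_continuous.
Qed.

Let z_holdings j : holdings z j = holdings v j.
Proof.
have H : (fun k => holdings (w k) j) @ \oo --> holdings z j.
  by apply: (sum_to (f := fun k q => w k j q)) => q; apply: w_to.
have E1 : (fun k => holdings (w k) j) = fun=> holdings v j.
  by apply/funext => k; have [_ _ ->] := wP k.
by rewrite E1 in H; apply: norm_cvg_unique H _; apply: cvg_cst.
Qed.

Let support_to : (fun k => support (w k) p) @ \oo --> support z p.
Proof.
apply: (cvgMl_tmp (g := fun k => \sum_j w k j p)).
by apply: (sum_to (f := fun k j => w k j p)) => j; apply: w_to.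
Qed.

Let z_ub j k : w k j p <= z j p.
Proof.
apply: (nondecreasing_cvgn_le (u_ := fun k => w k j p)); last exact: w_cvg.
by apply/nondecreasing_seqP => i; apply: (w_step i).1.
Qed.

Let z_support : (cost p)%:R <= support z p.
Proof.
rewrite leNgt; apply/negP => zc.
have [j vj zj] : exists2 j, 0 < v j p & z j p < holdings v j.
  apply/exists_inP; apply: contraLR zc; rewrite negb_exists_in => /forall_inP H.
  rewrite -leNgt (le_trans pot) // ler_pM2l //.
  rewrite [leRHS](bigID (fun j => 0 < v j p)) /= -[leLHS]addr0 lerD //.
    by apply: ler_sum => j vj; rewrite leNgt H.
  by apply: sumr_ge0.
have wj k : 0 < w k j p.
  elim: k => // k /lt_le_trans; apply; exact: (w_step k).1.
have step k : w k.+1 j p * (support (w k) p / (cost p)%:R) = w k j p.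
  by apply: (w_step k).2.2 => //; apply: le_lt_trans zj.
have H1 : (fun k => w k.+1 j p * (support (w k) p / (cost p)%:R)) @ \oo
    --> z j p * (support z p / (cost p)%:R).
  apply: cvgM; first by rewrite (cvg_shiftS (fun k => w k j p)); apply: w_to.
  by apply: cvgMr_tmp; apply: support_to.
have H2 : (fun k => w k.+1 j p * (support (w k) p / (cost p)%:R)) @ \oo --> z j p.
  by rewrite (funext step); apply: w_to.
have zp : 0 < z j p by apply: lt_le_trans (z_ub j 0).
have e : support z p / (cost p)%:R = 1.
  apply: (mulfI (lt0r_neq0 zp)); rewrite mulr1.
  exact: norm_cvg_unique H1 H2.
by move: zc; rewrite -[X in _ < X]mul1r -ltr_pdivrMr // e ltxx.
Qed.

Lemma transfer_supportP : [/\ nonneg z, forall j, holdings z j = holdings v j &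
  (cost p)%:R <= support z p].
Proof. by []. Qed.

End RaiseLimit.

Lemma mt_rule_feasible (tie : tie_breaking R) fund_score accept_score :
  (bundle_cost (mt_rule (E := E) tie fund_score accept_score) <= limit E)%N.
Proof.
rewrite /mt_rule; set s := iter #|project E| (mt_step _ _) _.
suff: (bundle_cost (selected s) <= limit E)%N.
  elim: #|project E| => //= k IH /IH; set t := iter k _ _ => {}IH.
  rewrite /accept_step; case: ifP => // a0 /=.
  have := best_in tie (accept_score (value t)) a0; rewrite inE => /andP[_].
  exact: leq_trans (bundle_costU1 _ _).
apply: (feasible_cost (v := value s)); rewrite {}/s.
elim: #|project E| => [|k IH] //=.
set s := iter k _ _ in IH *; rewrite /mt_step; case: ifP => [e0|e0].
  apply: feasible_fund => //.
  by have := best_in tie (fund_score (value s)) e0; rewrite inE => /andP[].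
case: ifP => // t0; set p := best _ _ _.
have := best_in tie (fund_score (value s)) t0; rewrite -/p inE => /andP[pr pot].
have sc : support (value s) p < (cost p)%:R.
  rewrite ltNge; apply/negP => sp; suff: eligible s != set0 by rewrite e0.
  by apply/set0Pn; exists p; rewrite inE pr.
have s0 : 0 < support (value s) p.
  have [//|sn] := ltP 0 (support (value s) p).
  have : potential (value s) p <= 0.
    rewrite /potential big1 ?mulr0 // => j vj; exfalso; move: sn.
    rewrite leNgt => /negP; apply; rewrite mulr_gt0 // (bigD1 j) //=.
    by rewrite ltr_wpDr // sumr_ge0 // => i _; apply: IH.1.
  by move/(le_trans pot); rewrite leNgt cost_pos.
have [z0 zh zc] := transfer_supportP IH.1 s0 (ltW sc) pot.
apply: feasible_fund => //=.
by apply: feasible_le IH z0 _ => j; rewrite zh.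
Qed.

End Feasibility.

Section Rules.
Variables (R : realType) (tie : tie_breaking R).

Definition EwT : aggregation_method R :=
  AggregationMethod (outcome := fun E => ew_rule tie (@excess R E) (@excess R E))
    (fun E => ew_rule_feasible tie _ _).

Definition EwTC : aggregation_method R :=
  AggregationMethod
    (outcome := fun E => ew_rule tie (@support_per_cost R E)
       (fun v p => excess v p / (cost p)%:R))
    (fun E => ew_rule_feasible tie _ _).

Definition MT : aggregation_method R :=
  AggregationMethod
    (outcome := fun E => mt_rule tie (@excess R E)
       (fun v p => potential v p - (cost p)%:R))
    (fun E => mt_rule_feasible tie _ _).

Definition MTC : aggregation_method R :=
  AggregationMethod
    (outcome := fun E => mt_rule tie (@support_per_cost R E)
       (fun v p => (cost p)%:R^-1 * potential v p))
    (fun E => mt_rule_feasible tie _ _).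

End Rules.

(* Main.v *)
(* MT and MTC. Let p be a project of P' that is still available. A voter of V'
   is then either broke or has positive value on exactly the available projects
   of P'; hence redistribution never burns her money, and the money of V' plus
   the costs of the selected projects of P' never drops below l. When the
   transfer phase stops, p is not eligible by transfers, so c(p) exceeds the
   money that V' still holds, which is at least l minus the cost of the selected
   projects of P'. Neither the scores nor the ties matter, and the acceptance
   phase can only add projects.

   EwT and EwTC. Let L = 8 and let the costs of a, b, c be 4, 6, 5. One voter
   gives 1/8 to a and 7/8 to b, the other one gives everything to c. Both rules
   eliminate a, then b, whose money is lost, then c; in the reverse order c is
   added first and leaves no room for b or a, although the first voter alone
   deserves l = 4 = c(a). *)
From mathcomp Require Import all_boot all_order all_algebra reals.
From mathcomp Require Import classical_sets boolp topology normedtype sequences.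
From mathcomp Require Import lra.
From mathcomp Require Import fintype finset.
(* Imported last: [support] is also a notation of [ssralg]. *)
Require Import Defs.

Set Implicit Arguments.
Unset Strict Implicit.
Unset Printing Implicit Defensive.
Import Order.TTheory GRing.Theory Num.Theory.
Import numFieldNormedType.Exports.
Local Open Scope ring_scope.

(** * Values, holdings and choices under ties *)

Section Scenario.
Variables (R : realType) (E : scenario R).
Implicit Types (v w : values E) (p q : project E) (j : voter E).
Implicit Types (A : {set project E}) (s : state E).

Lemma unit_value_gt0 : 0 < unit_value E.
Proof. by rewrite divr_gt0 ?ltr0n ?limit_gt0 ?voter_gt0. Qed.

Lemma holdingsD1 v j p : holdings v j = v j p + \sum_(q | q != p) v j q.
Proof. by rewrite /holdings (bigD1 p). Qed.

Section Best.
Variable tie : tie_breaking R.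

Lemma best_in A score : A != set0 -> best tie A score \in A.
Proof.
case/set0Pn => p0 p0A.
have [|//] := setIdP (tie_choice_in tie (A := [set p in A |
    [forall q in A, score q <= score p]]) _).
apply/set0Pn; have [p pA pmax] := arg_maxP score p0A.
by exists p; rewrite inE; apply/andP; split => //; apply/forall_inP.
Qed.

(** A strict maximiser is the only candidate, so every tie-breaking rule picks it; this fixes the
    run of the counterexample for all [tie]. *)
Lemma best_eq A score p : p \in A ->
  (forall q, q \in A -> q != p -> score q < score p) -> best tie A score = p.
Proof.
move=> pA pmax.
have [|bA /forall_inP bmax] := setIdP (tie_choice_in tie (A := [set p in A |
    [forall q in A, score q <= score p]]) _).
  apply/set0Pn; exists p; rewrite inE pA; apply/forall_inP => q qA.
  by have [->//|/(pmax _ qA)/ltW] := eqVneq q p.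
by apply/eqP/negPn/negP => /(pmax _ bA); rewrite ltNge bmax.
Qed.

End Best.

(** * The limit of the transfers towards a project *)

Section TransferLimit.
Variables (p : project E) (v : values E).
Hypotheses (v_ge0 : forall j q, 0 <= v j q) (v_supp : 0 < support v p)
  (v_cost : support v p <= (cost p)%:R).

Lemma raise_scale w j :
  exists t, forall q, q != p -> raise p w j q = w j q * t.
Proof.
rewrite /raise /=; case: ifP => _; last by exists 1 => q _; rewrite mulr1.
case wp: (0 < w j p); last by exists 1 => q _; rewrite mulr1.
set x := Num.min _ _; exists (1 - (x - w j p) / \sum_(q' | q' != p) w j q').
by move=> q /negbTE qp; rewrite qp mulrBr mulr1 mulrCA.
Qed.

Let w k := iter k (raise p) v.

Lemma iter_raiseP k : [/\ forall j q, 0 <= w k j q,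
  0 < support (w k) p <= (cost p)%:R & forall j, holdings (w k) j = holdings v j].
Proof.
elim: k => [|k [w0 /andP[s0 sc] wh]]; first by rewrite v_supp v_cost.
by have [r0 rs rh _] := raiseP w0 s0 sc; split=> // j; rewrite rh.
Qed.

Lemma iter_raise_monotone k : (forall j, w k j p <= w k.+1 j p) /\
  (forall j q, q != p -> w k.+1 j q <= w k j q).
Proof.
have [w0 /andP[s0 sc] _] := iter_raiseP k.
by have [_ _ _ [up [down _]]] := raiseP w0 s0 sc.
Qed.

Lemma iter_raise_cvg j q :
  ((fun k => w k j q) @ \oo --> transfer_support p v j q)%classic.
Proof.
(* [transfer_support] is defined as this limit, so convergence suffices: on [p] the sequence rises
   and is bounded by the holdings, elsewhere it falls and is bounded by 0. *)
suff : cvgn (fun k => w k j q) by [].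
have [->|qp] := eqVneq q p.
  apply: nondecreasing_is_cvgn.
    by apply/nondecreasing_seqP => k; apply: (iter_raise_monotone k).1.
  exists (holdings v j) => _ [k _ <-]; have [w0 _ <-] := iter_raiseP k.
  by rewrite (holdingsD1 _ _ p) lerDl sumr_ge0.
apply: nonincreasing_is_cvgn.
  by apply/nonincreasing_seqP => k; apply: (iter_raise_monotone k).2.
by exists 0 => _ [k _ <-]; have [w0 _ _] := iter_raiseP k.
Qed.

(** Each round keeps the support of [p] at most its cost, and the bound passes to the limit; hence
    the funding that follows finds no excess to redistribute. *)
Lemma transfer_support_le_cost : support (transfer_support p v) p <= (cost p)%:R.
Proof.
have cvg_supp : ((fun k => support (w k) p) @ \oo
    --> support (transfer_support p v) p)%classic.
  apply: (cvgMl_tmp (g := fun k => \sum_j w k j p)).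
  apply: (@cvg_big R _ +%R 0 xpredT _ nat _ _ (fun j k => w k j p)) => //.
    exact: add_continuous.
  by move=> j _; apply: iter_raise_cvg.
rewrite -(cvg_lim _ cvg_supp) //; apply: limr_le.
  by apply/cvg_ex; eexists; exact: cvg_supp.
by apply: nearW => k; have [_ /andP[_]] := iter_raiseP k.
Qed.

(** Each round scales a voter's values off [p] by one factor, so their ratios survive;
    cross-multiplying avoids division by zero values. Hence she keeps all or none of her positive
    values off [p]. *)
Lemma transfer_support_proportional j q q' : q != p -> q' != p ->
  transfer_support p v j q * v j q' = transfer_support p v j q' * v j q.
Proof.
move=> qp q'p; have wE k : w k j q * v j q' = w k j q' * v j q.
  elim: k => [|k IH]; first by rewrite mulrC.
  have [t wt] := raise_scale (w k) j.
  by rewrite /w /= !wt // mulrAC IH mulrAC.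
have c1 : ((fun k => w k j q * v j q') @ \oo
    --> transfer_support p v j q * v j q')%classic.
  by apply: cvgMr_tmp; apply: iter_raise_cvg.
have c2 : ((fun k => w k j q' * v j q) @ \oo
    --> transfer_support p v j q' * v j q)%classic.
  by apply: cvgMr_tmp; apply: iter_raise_cvg.
by move: c1; rewrite (funext wE) => c1; apply: norm_cvg_unique c1 c2.
Qed.

Lemma transfer_support_id j q : v j p = 0 -> transfer_support p v j q = v j q.
Proof.
move=> vp; have wE k : w k j =1 v j.
  elim: k => //= k IH q'; rewrite /raise /=; case: ifP => _; last exact: IH.
  by rewrite IH vp ltxx IH.
by rewrite /transfer_support (funext (wE^~ q)) lim_cst.
Qed.

Lemma transfer_support_down j q : q != p -> transfer_support p v j q <= v j q.
Proof.
move=> qp; apply: limr_le; first exact: iter_raise_cvg.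
apply: nearW => k; elim: k => //= k; apply: le_trans.
exact: (iter_raise_monotone k).2.
Qed.

End TransferLimit.

(** * Redistribution of an excess *)

Lemma gammaP (rest : {set project E}) p v : (forall j, 0 <= v j p) ->
  0 <= gamma rest p v < 1 /\
  gamma rest p v * unit_value E * \sum_(j in tran rest p v) v j p <= (cost p)%:R.
Proof.
move=> v0; rewrite /gamma; case: xgetP => [g _ [g01 <-]|_].
  by split=> //; rewrite lerDl mulr_ge0 ?(ltW unit_value_gt0) ?sumr_ge0.
(* The default 0 of [gamma] makes the left side vanish. *)
by rewrite lexx ltr01 !mul0r ler0n.
Qed.

Lemma ballot_share_ge0 (rest : {set project E}) j q :
  0 <= ballot j q / \sum_(q' in rest) ballot j q'.
Proof.
by rewrite divr_ge0 ?ballot_ge0 // sumr_ge0 // => *; apply: ballot_ge0.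
Qed.

Lemma redistribute_ge0 (rest : {set project E}) p v :
  (forall j q, 0 <= v j q) -> forall j q, 0 <= redistribute rest p v j q.
Proof.
move=> v0 j q; rewrite /redistribute; case: ifP => // _.
have [/andP[g0 g1] _] := gammaP rest (v0 ^~ p).
rewrite /transfer; case: ifP => // _; have [_|_] := eqVneq q p.
  by rewrite mulrBl mul1r opprB addrC subrK mulr_ge0.
case: ifP => // _.
by rewrite addr_ge0 // mulr_ge0 ?ballot_share_ge0 // mulr_ge0 ?subr_ge0 ?(ltW g1).
Qed.

(** * Redistribution seen from a cohesive group *)

Section Cohesive.
Variables (V' : {set voter E}) (P' : {set project E}).
Hypothesis V'_ballot : forall j, j \in V' -> forall p, (0 < ballot j p) = (p \in P').

Definition spread (rest : {set project E}) (v : values E) j : Prop :=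
  (forall q, v j q = 0) \/ (forall q, (0 < v j q) = (q \in P' :&: rest)).

Section Redistribute.
Variables (rest : {set project E}) (p p' : project E) (v : values E).
Hypotheses (v_ge0 : forall j q, 0 <= v j q) (pP' : p \in P') (pr : p \in rest)
  (pp' : p != p').

(** Shares follow the initial ballots: a voter of [V'] passes nothing outside [P'], and inside [P']
    every available project was already positive for her unless she is broke. *)
Lemma redistribute_spread j q : j \in V' -> spread rest v j -> q != p' ->
  (0 < redistribute rest p' v j q) = (0 < v j q).
Proof.
move=> jV' vs qp'; rewrite /redistribute; case: ifP => // _; rewrite /transfer.
case: ifP => // jt; rewrite (negbTE qp').
case: ifP => // qr; case: vs => [v0|vs].
  by move: jt; rewrite inE v0 ltxx.
rewrite vs inE qr andbT; have [qP'|qP'] := boolP (q \in P').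
  have [/andP[g0 g1] _] := gammaP rest (v_ge0 ^~ p').
  rewrite ltr_wpDr //; last by rewrite vs inE qP'.
  by rewrite mulr_ge0 ?ballot_share_ge0 // mulr_ge0 ?subr_ge0 ?(ltW g1).
have -> : ballot j q = 0.
  by apply/le_anti; rewrite ballot_ge0 andbT leNgt V'_ballot.
by rewrite mul0r mulr0 addr0 vs inE (negbTE qP').
Qed.

(** The available project [p] of [P'] has a positive ballot from [j], so the denominator of the
    shares is nonzero and they add up to 1. *)
Lemma redistribute_holdings j : j \in V' ->
  holdings (redistribute rest p' v) j = holdings v j.
Proof.
move=> jV'; rewrite /redistribute; case: ifP => // _.
rewrite !(holdingsD1 _ _ p') /transfer eqxx; case: ifP => // jt.
set a := _ * v j p'; set D := \sum_(q in rest :\ p') ballot j q.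
have D_gt0 : 0 < D.
  rewrite /D (bigD1 p) ?inE ?pp' //= ltr_wpDr ?V'_ballot //.
  by apply: sumr_ge0 => *; apply: ballot_ge0.
rewrite (eq_bigr (fun q => v j q
    + (if q \in rest then a * (ballot j q / D) else 0))); last first.
  by move=> q /negbTE ->; case: ifP => _ //; rewrite addr0.
rewrite big_split /= -big_mkcondr /= -mulr_sumr -mulr_suml.
have -> : \sum_(q | (q != p') && (q \in rest)) ballot j q = D.
  by apply: eq_bigl => q; rewrite !inE.
by rewrite divff ?gt_eqF // mulr1 [X in _ + X]addrC addrA subrK.
Qed.

(** If there is an excess, a voter of [V'] with value on [p'] also has value on the available [p];
    so she lies in [tran], whose members together pay at most the cost. If [p'] is outside [P'], she
    has no value there to pay with. *)
Lemma redistribute_payment : (forall j, j \in V' -> spread rest v j) ->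
  unit_value E * \sum_(j in V') redistribute rest p' v j p' <=
    if p' \in P' then (cost p')%:R else 0.
Proof.
move=> vs; have sumV' w : (forall j q, 0 <= w j q) ->
    \sum_(j in V') w j p' <= \sum_j w j p'.
  by move=> w0; rewrite [leRHS](bigID (mem V')) /= lerDl sumr_ge0.
have V'0 j : j \in V' -> p' \notin P' -> v j p' = 0.
  move=> /vs[->//|vj] p'P'; apply/le_anti; rewrite v_ge0 andbT leNgt vj.
  by rewrite inE (negbTE p'P').
rewrite /redistribute; case: ifP => [_|/negbT]; last first.
  rewrite -leNgt; case: ifPn => [_ vc|p'P' _].
    by apply: le_trans vc; rewrite ler_pM2l ?unit_value_gt0 ?sumV'.
  by rewrite big1 ?mulr0 // => j /V'0->.
have [/andP[g0 g1] gc] := gammaP rest (v_ge0 ^~ p').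
rewrite /transfer; case: ifPn => [_|p'P']; last first.
  rewrite big1 ?mulr0 // => j jV'.
  by rewrite inE V'0 // ltxx.
apply: le_trans gc; rewrite -mulrA mulrCA ler_pM2l ?unit_value_gt0 //.
rewrite mulr_sumr [leRHS](bigID (mem V')) /= -[leLHS]addr0 lerD //; last first.
  by apply: sumr_ge0 => j _; rewrite mulr_ge0.
rewrite [leRHS]big_andbC [leRHS]big_mkcondr /=; apply: ler_sum => j jV'.
rewrite eqxx; case: ifP => [_|jt]; first by rewrite mulrBl mul1r opprB addrC subrK.
case: (vs j jV') => [->//|vj]; rewrite leNgt; apply/negP => vp'.
move: jt; rewrite inE vp' => /existsP[]; exists p.
by rewrite !inE pp' pr vj inE pP' pr.
Qed.

End Redistribute.
Lemma pay_holdings p v j : holdings (pay p v) j = holdings v j - v j p.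
Proof.
rewrite !(holdingsD1 _ _ p) /pay eqxx add0r [v j p + _]addrC addrK.
by apply: eq_bigr => q /negbTE ->.
Qed.

(** * The invariant of the funding loop *)

Section Run.
Variables (tie : tie_breaking R) (fund_score : values E -> project E -> R).
Variable l : nat.

Definition endowed (v : values E) (S : {set project E}) : Prop :=
  l%:R <= unit_value E * (\sum_(j in V') holdings v j) + (bundle_cost (P' :&: S))%:R.

Definition invariant (s : state E) : Prop :=
  [/\ forall j q, 0 <= value s j q, eliminated s = [::],
      forall j, j \in V' -> spread (remaining s) (value s) j &
      endowed (value s) (selected s)].

Lemma remainingE s : eliminated s = [::] -> remaining s = ~: selected s.
Proof. by move=> e; apply/setP => q; rewrite !inE e andbT. Qed.

(** What [V'] pays for [p] is at most what the new project [p] adds to the cost of [P' :&: S]. *)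
Lemma endowed_pay v w (S : {set project E}) p : endowed v S -> p \notin S ->
  (forall j, j \in V' -> holdings w j = holdings v j) ->
  unit_value E * \sum_(j in V') w j p <= (if p \in P' then (cost p)%:R else 0) ->
  endowed (pay p w) (p |: S).
Proof.
move=> en pS wh wp; apply: le_trans en _.
under [X in _ <= _ * X + _]eq_bigr => j jV' do rewrite pay_holdings wh //.
rewrite sumrB mulrBr -addrA lerD2l [leRHS]addrC lerBrDr setIUr.
have -> : P' :&: [set p] = if p \in P' then [set p] else set0.
  case: ifP => pP'; first by rewrite (setIidPr _) ?sub1set.
  by apply: disjoint_setI0; rewrite disjoint_sym disjoints1 pP'.
case: ifP wp => pP' wp; last first.
  by rewrite set0U gerDl.
rewrite /bundle_cost big_setU1 ?inE ?(negbTE pS) ?andbF //=.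
by rewrite natrD addrC lerD2r.
Qed.

Lemma spread_pay s p' w j : eliminated s = [::] ->
  (forall q, q != p' -> (0 < w j q) = (q \in P' :&: remaining s)) ->
  (forall q, 0 <= w j q) ->
  forall q, (0 < pay p' w j q) = (q \in P' :&: ~: (p' |: selected s)).
Proof.
move=> e wq w0 q; rewrite /pay !inE negb_or; have [->|qp'] := eqVneq q p'.
  by rewrite ltxx andbF.
by rewrite wq // !inE e andbT.
Qed.

Lemma invariant_fund s p p' : invariant s -> p \in P' -> p \in remaining s ->
  p' \in remaining s -> p != p' -> invariant (fund p' s).
Proof.
move=> [v0 e vs en] pP' pr p'r pp'; split=> //.
- by move=> j q; rewrite /= /pay; case: ifP => // _; apply: redistribute_ge0.
- move=> j jV'; rewrite remainingE //=.
  have rs := redistribute_spread v0 jV' (vs j jV').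
  case: (vs j jV') => [vj0|vj].
    left=> q; rewrite /pay; case: ifPn => // qp'; apply/le_anti.
    by rewrite redistribute_ge0 // andbT leNgt rs // vj0 ltxx.
  right; apply: spread_pay => // [q qp'|q]; first by rewrite rs // vj.
  exact: redistribute_ge0.
- apply: endowed_pay en _ _ _; first by move: p'r; rewrite inE => /andP[].
    by move=> j; apply: (redistribute_holdings _ pP' pr pp').
  exact: (redistribute_payment v0 pP' pr pp').
Qed.

(** Without a supporter the potential is 0, below every cost. Positive support keeps the ratio [r]
    in [raise] away from 0. *)
Lemma potential_support_gt0 v p : (forall j q, 0 <= v j q) ->
  (cost p)%:R <= potential v p -> 0 < support v p.
Proof.
move=> v0 pot; have [//|sn] := ltP 0 (support v p).
have : (cost p)%:R <= 0 :> R.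
  apply: le_trans pot _; rewrite /potential big1 ?mulr0 // => j vj; exfalso.
  move: sn; rewrite leNgt => /negP; apply.
  by rewrite mulr_gt0 ?unit_value_gt0 // (bigD1 j) //= ltr_wpDr // sumr_ge0.
by rewrite lern0 -leqn0 leqNgt cost_gt0.
Qed.

Lemma invariant_transfer s p p' : invariant s -> p \in P' -> p \in remaining s ->
  p' \in remaining s -> p != p' -> support (value s) p' <= (cost p')%:R ->
  (cost p')%:R <= potential (value s) p' ->
  invariant (fund p'
    (State (transfer_support p' (value s)) (selected s) (eliminated s))).
Proof.
move=> [v0 e vs en] pP' pr p'r pp' sc pot.
have s0 := potential_support_gt0 v0 pot.
have [z0 zh _] := transfer_supportP v0 s0 sc pot.
have zc := transfer_support_le_cost v0 s0 sc.
set z := transfer_support p' (value s) in z0 zh zc *.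
have zdown := transfer_support_down v0 s0 sc; rewrite -/z in zdown.
have redE rest : redistribute rest p' z = z.
  by rewrite /redistribute ltNge zc.
have enz : endowed z (selected s).
  by rewrite /endowed; under eq_bigr do rewrite zh.
split=> //=.
- by move=> j q; rewrite redE /pay; case: ifP.
- move=> j jV'; rewrite redE remainingE //=.
  (* A voter who has moved all her money to [p'] is broke once she has paid. *)
  have pay0 : (forall q, q != p' -> z j q = 0) ->
      spread (~: (p' |: selected s)) (pay p' z) j.
    by move=> z00; left=> q; rewrite /pay; case: ifPn => // /z00.
  case: (vs j jV') => [vj0|vj].
    apply: pay0 => q qp'; apply/le_anti; rewrite z0 andbT.
    by rewrite -(vj0 q) zdown.
  (* Either nothing is left off [p'], or some [q1] keeps a positive value and, by proportionality,
     so does every other project off [p'] that she valued before. *)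
  have [zq|/forallPn[q1]] := boolP [forall q, (q != p') ==> (z j q == 0)].
    by apply: pay0 => q qp'; apply/eqP; move/forallP/(_ q): zq; rewrite qp'.
  rewrite negb_imply => /andP[q1p'] zq1; right; apply: spread_pay => // q qp'.
  have zq1_gt0 : 0 < z j q1 by rewrite lt_neqAle eq_sym zq1 z0.
  have vq1_gt0 : 0 < value s j q1 by apply: lt_le_trans zq1_gt0 (zdown _ _ q1p').
  rewrite -vj; apply/idP/idP => [/lt_le_trans -> //|vq]; first exact: zdown.
  rewrite -(pmulr_lgt0 _ vq1_gt0).
  by rewrite (transfer_support_proportional v0 s0 sc j qp' q1p') mulr_gt0.
- rewrite redE; apply: endowed_pay enz _ _ _ => //.
    by move: p'r; rewrite inE => /andP[].
  case: ifP => p'P'; last first.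
    rewrite big1 ?mulr0 // => j jV'; have vj0 : value s j p' = 0.
      have [->//|vj] := vs j jV'.
      by apply/le_anti; rewrite v0 andbT leNgt vj inE p'P'.
    by rewrite /z transfer_support_id.
  apply: le_trans zc; rewrite ler_pM2l ?unit_value_gt0 //.
  by rewrite [leRHS](bigID (mem V')) /= lerDl sumr_ge0.
Qed.

Lemma invariant_initial : l%:R <= unit_value E * #|V'|%:R -> invariant (initial E).
Proof.
move=> lV'; split=> //.
- by move=> j q; apply: ballot_ge0.
- by move=> j jV'; right=> q; rewrite /= V'_ballot // !inE andbT.
- rewrite /endowed /holdings /=; under eq_bigr do rewrite ballot_sum1.
  by rewrite sumr_const (le_trans lV') // lerDl ler0n.
Qed.

Let step := mt_step tie fund_score.

Lemma selected_mt_step s : selected s \subset selected (step s).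
Proof.
rewrite /step /mt_step; case: ifP => _ /=; first exact: subsetUr.
by case: ifP => _ //=; apply: subsetUr.
Qed.

(** As [p] is unselected after the step, the funded project differs from [p], and [p] serves as the
    project of [P'] that stays available. *)
Lemma invariant_mt_step s p : invariant s -> p \in P' -> p \notin selected (step s) ->
  invariant (step s).
Proof.
move=> invs pP'; have e : eliminated s = [::] by case: invs.
have r q q' : q \notin q' |: selected s -> q \in remaining s /\ q != q'.
  by rewrite !inE e negb_or andbT => /andP[].
rewrite /step /mt_step; case: ifPn => [el0|el0].
  have := best_in tie (fund_score (value s)) el0; rewrite inE => /andP[br _].
  by move=> /r[pr pb]; apply: invariant_fund pr br pb.
case: ifPn => // tr0.
have := best_in tie (fund_score (value s)) tr0; rewrite inE => /andP[br pot].
move=> /r[pr pb]; apply: (invariant_transfer invs pP' pr br pb _ pot).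
(* No project is eligible in this branch, so the support of [p'] is below its cost. *)
set p' := best _ _ _ in br *; move: el0; rewrite negbK => /eqP/setP/(_ p').
by rewrite inE br in_set0 /= leNgt => /negbT; rewrite negbK => /ltW.
Qed.

Definition stuck s := (eligible s == set0) && (transfer_eligible s == set0).

(** A step that finds the loop unfinished selects a new project, so as many steps as there are
    projects exhaust the loop. *)
Lemma mt_step_progress k s : let t := iter k step s in
  stuck t \/ (k <= #|selected t|)%N.
Proof.
elim: k => [|k IH] /=; first by right.
set t := iter k step s in IH *; have [st|st] := boolP (stuck t).
  left; rewrite /step /mt_step; case/andP: (st) => /eqP -> /eqP ->.
  by rewrite eqxx.
case: IH => [|kt]; first by rewrite (negbTE st).
right; apply: leq_trans (_ : #|selected t|.+1 <= _)%N => //.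
have sel q : q \in remaining t -> #|q |: selected t| = #|selected t|.+1.
  by rewrite inE cardsU1 => /andP[->].
rewrite /step /mt_step; case: ifPn => [el0|el0] /=.
  have := best_in tie (fund_score (value t)) el0; rewrite inE => /andP[br _].
  by rewrite sel.
case: ifPn => [tr0|tr0] /=.
  have := best_in tie (fund_score (value t)) tr0; rewrite inE => /andP[br _].
  by rewrite sel.
by move: st el0 tr0; rewrite /stuck !negbK => /negbTE + e1 e2; rewrite e1 e2.
Qed.

Lemma mt_loop_PR (p : project E) : let s := iter #|project E| step (initial E) in
  l%:R <= unit_value E * #|V'|%:R -> p \in P' -> p \notin selected s ->
  (l < cost p + bundle_cost (P' :&: selected s))%N.
Proof.
move=> s lV' pP' pS.
(* Selections only grow, so [p] was unselected throughout the run. *)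
have inv : invariant s.
  move: pS; rewrite /s; elim: #|project E| => [_|k IH] /=.
    exact: invariant_initial.
  move=> pS; apply: (invariant_mt_step _ pP' pS); apply: IH.
  by apply: contra pS; exact: (subsetP (selected_mt_step _)).
have [v0 e vs en] := inv.
have pr : p \in remaining s by rewrite inE pS e.
have [/andP[_ /eqP/setP/(_ p)]|] := mt_step_progress #|project E| (initial E); last first.
  (* Here every project would be selected, [p] included. *)
  rewrite -/s leqNgt => /negP[]; rewrite -cardsT proper_card // properT.
  by apply: contra pS => /eqP ->; rewrite inE.
rewrite in_set0 inE pr /= => /negbT; rewrite -ltNge => pot.
rewrite -(ltr_nat R) natrD; apply: le_lt_trans en _.
rewrite ltrD2r; apply: le_lt_trans pot; rewrite ler_pM2l ?unit_value_gt0 //.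
(* Term by term: a voter of [V'] who is not broke values [p] and counts in its potential; a broke
   one holds nothing. *)
rewrite big_mkcond [leRHS]big_mkcond /=; apply: ler_sum => j _.
case: ifP => [jV'|_]; last by case: ifP => // _; apply: sumr_ge0.
case: ifP => // vjp; have [vj0|] := vs j jV'; first by rewrite /holdings big1.
by move=> /(_ p); rewrite vjp inE pP' pr.
Qed.

End Run.
End Cohesive.

(** * From the loop to Strong-PR for the transfer rules *)

Lemma mt_rule_PR (tie : tie_breaking R) fund_score accept_score (l : nat)
    (V' : {set voter E}) (P' : {set project E}) p :
  l%:R * #|voter E|%:R / (limit E)%:R <= #|V'|%:R :> R ->
  (forall j, j \in V' -> forall q, (0 < ballot j q) = (q \in P')) ->
  p \in P' -> p \notin mt_rule tie fund_score accept_score ->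
  (l < cost p + bundle_cost (P' :&: mt_rule tie fund_score accept_score))%N.
Proof.
move=> lV' V'b pP'; rewrite /mt_rule; set s := iter _ (mt_step _ _) _.
have sub k : selected s \subset selected (iter k (accept_step tie accept_score) s).
  elim: k => //= k /subset_trans; apply; rewrite /accept_step.
  by case: ifP => // _ /=; apply: subsetUr.
set T := selected (iter _ (accept_step _ _) _) => pT.
have pS : p \notin selected s by apply: contra pT; exact: (subsetP (sub _)).
apply: leq_trans (mt_loop_PR (V' := V') V'b _ pP' pS) _.
  (* The size condition on [V'] says that its initial money, [unit_value E] per voter, is at least
     [l]. *)
  rewrite mulrC -ler_pdivrMr ?unit_value_gt0 //; move: lV'.
  by rewrite /unit_value invf_div mulrA.
rewrite leq_add2l /bundle_cost [X in (_ <= X)%N](bigID (mem (selected s))) /=.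
apply: leq_trans (leq_addr _ _).
rewrite [X in (_ <= X)%N](eq_bigl (mem (P' :&: selected s))) // => q; rewrite !inE.
case: (boolP (q \in selected s)); rewrite ?andbF ?andbT //.
by move=> /(subsetP (sub #|project E|)) ->; rewrite andbT.
Qed.

End Scenario.

Lemma mt_strong_PR (R : realType) (M : aggregation_method R) (tie : tie_breaking R)
    fund_score accept_score :
  (forall E : scenario R, M E = mt_rule tie (fund_score E) (accept_score E)) ->
  strong_PR M.
Proof.
(* The second alternative always holds; it is vacuous when [P'] lies inside the outcome. *)
move=> ME E l V' P' _ lV' V'b; right=> p; rewrite ME in_setD => /andP[pM pP'].
exact: (mt_rule_PR lV' V'b).
Qed.

(** * A scenario on which the elimination rules fail *)

Section Elimination.
Variable R : realType.

Definition ew_cost (p : 'I_3) : nat := nth 1%N [:: 4; 6; 5]%N p.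

Definition ew_ballot (j : bool) (p : 'I_3) : R :=
  if j then nth 0 [:: 1 / 8; 7 / 8; 0] p else nth 0 [:: 0; 0; 1] p.

Lemma ew_cost_gt0 p : (0 < ew_cost p)%N.
Proof. by case: p => [[|[|[|[]]]]]. Qed.

Lemma ew_ballot_ge0 j p : 0 <= ew_ballot j p.
Proof. by case: j; case: p => [[|[|[|[]]]]] // ?; rewrite /ew_ballot /=; lra. Qed.

Lemma ew_ballot_sum1 j : \sum_p ew_ballot j p = 1.
Proof. by case: j; rewrite !big_ord_recl big_ord0 /ew_ballot /=; lra. Qed.

Lemma card_bool_gt0 : (0 < #|{: bool}|)%N. Proof. by rewrite card_bool. Qed.

Definition ew_scenario : scenario R :=
  @Scenario R 'I_3 bool ew_cost ew_ballot 8 ew_cost_gt0 card_bool_gt0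
    ew_ballot_ge0 ew_ballot_sum1 isT.

Let a : project ew_scenario := @Ordinal 3 0 isT.
Let b : project ew_scenario := @Ordinal 3 1 isT.
Let c : project ew_scenario := @Ordinal 3 2 isT.

Lemma ew_projectP (Q : project ew_scenario -> Prop) : Q a -> Q b -> Q c -> forall p, Q p.
Proof.
move=> Qa Qb Qc [[|[|[|//]]] i].
- by rewrite (_ : Ordinal i = a) //; apply: val_inj.
- by rewrite (_ : Ordinal i = b) //; apply: val_inj.
- by rewrite (_ : Ordinal i = c) //; apply: val_inj.
Qed.

Lemma ew_excess (v : values ew_scenario) p :
  excess v p = 4 * (v true p + v false p) - (ew_cost p)%:R.
Proof.
rewrite /excess /support /unit_value /= card_bool; congr (_ * _ - _); first by lra.
exact: big_bool.
Qed.

Lemma ew_ineligible (s : state ew_scenario) :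
  (forall p, p \in remaining s -> excess (value s) p < 0) -> eligible s = set0.
Proof.
move=> neg; apply/setP => p; rewrite inE in_set0; apply/negbTE/negP => /andP[/neg].
by rewrite subr_lt0 ltNge => /negbTE ->.
Qed.

Section Run.
Variables (tie : tie_breaking R).
Variables (fund_score elim_score : values ew_scenario -> project ew_scenario -> R).
Hypothesis elim_scoreP : (forall v p, elim_score v p = excess v p) \/
  (forall v p, elim_score v p = excess v p / (cost p)%:R).

Let step := ew_step tie fund_score elim_score.

Lemma ew_step_eliminate s p : p \in remaining s ->
  (forall q, q \in remaining s -> excess (value s) q < 0) ->
  (forall q, q \in remaining s -> q != p -> elim_score (value s) p < elim_score (value s) q) ->
  step s = eliminate p s.
Proof.
move=> pr neg pmin; rewrite /step /ew_step ew_ineligible // eqxx /=.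
rewrite ifT; last by apply/set0Pn; exists p.
by rewrite (best_eq tie pr) // => q qr qp; rewrite ltrN2 pmin.
Qed.

Let s1 := eliminate a (initial ew_scenario).
Let s2 := eliminate b s1.

(** The excesses of [a], [b], [c] are -7/2, -5/2, -1, and per cost -7/8, -5/12, -1/5: all negative,
    with [a] strictly lowest for both scores. *)
Lemma step_initial : step (initial ew_scenario) = s1.
Proof.
apply: ew_step_eliminate; first by rewrite !inE.
  by apply: ew_projectP => _; rewrite ew_excess /= /ew_ballot /ew_cost /=; lra.
by apply: ew_projectP => _ //= _; case: elim_scoreP => eq;
  rewrite !eq !ew_excess /= /ew_ballot /ew_cost /=; lra.
Qed.

(** The only remaining project that voter [true] initially supports is [b], which receives her whole
    1/8 from [a]. *)
Lemma value_s1 j p : value s1 j p = if j then (p == b)%:R else (p == c)%:R.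
Proof.
rewrite /s1 /= /transfer_eliminated /transfer inE.
case: j => /=; last first.
  by rewrite /ew_ballot ltxx /=; move: p; apply: ew_projectP.
rewrite ifT; last first.
  rewrite /ew_ballot /=; apply/andP; split; first by lra.
  by apply/existsP; exists b; rewrite !inE /=; lra.
have -> : \sum_(q in remaining (initial ew_scenario) :\ a) ew_ballot true q = 7 / 8.
  by rewrite big_mkcond !big_ord_recl big_ord0 !inE /ew_ballot /=; lra.
move: p; apply: ew_projectP; rewrite ?inE /ew_ballot /=; lra.
Qed.

(** The excesses of [b] and [c] are now -2 and -1, and per cost -1/3 and -1/5. *)
Lemma step_s1 : step s1 = s2.
Proof.
apply: ew_step_eliminate; first by rewrite !inE.
  by apply: ew_projectP => _; rewrite ew_excess !value_s1 /= /ew_cost /=; lra.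
apply: ew_projectP => [|_|_ _]; first by rewrite !inE.
  by rewrite eqxx.
by case: elim_scoreP => eq; rewrite !eq !ew_excess !value_s1 /= /ew_cost /=; lra.
Qed.

(** Voter [true] initially supports only [a] and [b], so she has nowhere to transfer; voter [false]
    has nothing on [b]. *)
Lemma value_s2 j p : value s2 j p = value s1 j p.
Proof.
rewrite -[LHS]/(transfer_eliminated (remaining s1) b (value s1) j p).
rewrite /transfer_eliminated /transfer inE.
rewrite ifF //; apply/negbTE; case: j; rewrite value_s1 /= ?ltxx //.
rewrite negb_and negb_exists; apply/orP; right; apply/forallP.
by apply: ew_projectP; rewrite !inE /= /ew_ballot /= ?ltxx.
Qed.

Lemma step_s2 : step s2 = eliminate c s2.
Proof.
apply: ew_step_eliminate; first by rewrite !inE.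
  apply: ew_projectP => [|| _]; [by rewrite !inE|by rewrite !inE|].
  by rewrite ew_excess !value_s2 !value_s1 /= /ew_cost /=; lra.
by apply: ew_projectP; rewrite !inE.
Qed.

Lemma ew_rule_scenario : ew_rule tie fund_score elim_score = [set c].
Proof.
rewrite /ew_rule card_ord [iter 3 _ _]/= -/step step_initial step_s1 step_s2.
rewrite /reverse_eliminations /= /affordable /bundle_cost big_set0 /=.
(* [c] uses 5 of the budget 8; neither [b] (6) nor [a] (4) fits into the remaining 3. *)
by rewrite setU0 !big_set1 (_ : (ew_cost c + ew_cost b <= 8)%N = false) // big_set1.
Qed.

End Run.

Lemma ew_not_strong_PR (M : aggregation_method R) : M ew_scenario = [set c] -> ~ strong_PR M.
Proof.
(* For [l] = 4 the required group size is 4 * 2 / 8 = 1, met by voter [true] alone. *)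
move=> Mc /(_ ew_scenario 4%N [set true] [set a; b] isT).
have h1 : 4%:R * #|voter ew_scenario|%:R / (limit ew_scenario)%:R
    <= #|[set true : voter ew_scenario]|%:R :> R.
  by rewrite cards1 card_bool /=; lra.
have h2 j : j \in [set true : voter ew_scenario] ->
    forall p, (0 < ballot j p) = (p \in [set a; b]).
  rewrite inE => /eqP ->; apply: ew_projectP; rewrite !inE /= /ew_ballot /= ?eqxx ?ltxx //.
    by apply/idP; lra.
  by apply/idP; lra.
case/(_ h1 h2) => [/subsetP/(_ a)|/(_ a)]; rewrite Mc !inE //=.
  by move=> /(_ isT).
(* [a] costs exactly 4 and the outcome contains nothing of [[set a; b]], so the strict inequality 4
   < 4 + 0 fails. *)
move/(_ isT); rewrite /bundle_cost big1 ?addn0 // => p.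
by move: p; apply: ew_projectP; rewrite !inE.
Qed.

End Elimination.

Theorem theorem6 (R : realType) (tie : tie_breaking R) :
  (strong_PR (MT tie) /\ strong_PR (MTC tie)) /\
  (~ strong_PR (EwT tie) /\ ~ strong_PR (EwTC tie)).
Proof.
split; split.
- exact: (@mt_strong_PR R (MT tie) tie (@excess R)
    (fun E v p => potential v p - (cost p)%:R) (fun=> erefl)).
- exact: (@mt_strong_PR R (MTC tie) tie (@support_per_cost R)
    (fun E v p => (cost p)%:R^-1 * potential v p) (fun=> erefl)).
- by apply: ew_not_strong_PR; apply: ew_rule_scenario; left.
- by apply: ew_not_strong_PR; apply: ew_rule_scenario; right.
Qed.
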